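(* Let $K$ be a $p$-adic field, let $m\ge 1$, and let $f(x)=x+ax^{m+1}+\cdots$ and $g(x)=x+ax^{m+1}+\cdots$ be analytic functions (power series over $K$ with positive radius of convergence at $0$, where the omitted terms have degree $>m+1$), with the same coefficient $a\in K$, $a\neq 0$. Then $f$ is lipeomorphically equivalent to $g$.
   Context: A $p$-adic field ($p$ a prime) is a complete non-archimedean valued field $(K,|\cdot|)$ of characteristic zero with $|p|<1$, normalized so that $|p|=1/p$ (for example $\mathbb{Q}_p$ or $\mathbb{C}_p$). A power series $\sum_n a_nx^n\in K[[x]]$ is analytic (at $0$) if its radius of convergence is positive. A homeomorphism $h$ is a lipeomorphism if both $h$ and $h^{-1}$ are Lipschitz continuous. Two germs $f$, $g$ at $0$ fixing $0$ are lipeomorphically equivalent if they are intertwined by a lipeomorphic germ, i.e. there are neighborhoods of $0$ in $K$ and a lipeomorphism $h$ between them with $h(0)=0$ such that $h^{-1}\circ f\circ h=g$ near $0$. *)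

(* Defs.v *)
From HB Require Import structures.
From mathcomp Require Import all_boot all_order all_algebra.
From mathcomp Require Import all_classical all_reals all_analysis.

Set Implicit Arguments.
Unset Strict Implicit.
Unset Printing Implicit Defensive.

Import Order.TTheory GRing.Theory Num.Theory.
Import numFieldNormedType.Exports.

Local Open Scope classical_set_scope.
Local Open Scope ring_scope.

(* The norms of MathComp (normedZmodType) satisfy `|x *+ n| = `|x| *+ n, which
   rules out ultrametric norms; hence a separate absolute value. *)
Record valuedField (R : realType) := ValuedField {
  vfield : fieldType ;
  vabs : vfield -> R ;
  vabs_ge0 : forall x, 0 <= vabs x ;
  vabs_eq0 : forall x, vabs x = 0 <-> x = 0 ;
  vabsM : forall x y, vabs (x * y) = vabs x * vabs y ;
  vabsD_max : forall x y, vabs (x + y) <= Num.max (vabs x) (vabs y)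
}.

Definition vcarrier (R : realType) (K : valuedField R) : Type := vfield K.
Coercion vcarrier : valuedField >-> Sortclass.

HB.instance Definition _ (R : realType) (K : valuedField R) :=
  GRing.Field.on (vcarrier K).

Section ValuedFieldMetric.
Context {R : realType} {K : valuedField R}.

Definition vdist (x y : K) : R := vabs (x - y).

Lemma vabs0 : vabs (0 : K) = 0.
Proof. exact/vabs_eq0. Qed.

Lemma vabs1 : vabs (1 : K) = 1.
Proof.
have h : vabs (1 : K) != 0 by apply/eqP => /vabs_eq0/eqP; rewrite oner_eq0.
by apply: (mulfI h); rewrite -vabsM !mulr1.
Qed.

Lemma vabsN (x : K) : vabs (- x) = vabs x.
Proof.
suff h : vabs (-1 : K) = 1 by rewrite -mulN1r vabsM h mul1r.
have := vabsM (-1 : K) (-1).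
rewrite mulrNN mulr1 vabs1 => /esym/eqP; rewrite -expr2 sqrf_eq1.
case/orP => /eqP // h.
by have := vabs_ge0 (-1 : K); rewrite h oppr_ge0 ler10.
Qed.

Lemma vdistxx (x : K) : vdist x x = 0.
Proof. by rewrite /vdist subrr vabs0. Qed.

Lemma vdist_positivity (x y : K) : vdist x y = 0 -> x = y.
Proof. by move=> /vabs_eq0 /subr0_eq. Qed.

Lemma vdistC (x y : K) : vdist x y = vdist y x.
Proof. by rewrite /vdist -vabsN opprB. Qed.

Lemma vdist_triangle (y x z : K) : vdist x z <= vdist x y + vdist y z.
Proof.
rewrite /vdist (_ : x - z = (x - y) + (y - z)); last by rewrite addrA subrK.
apply: (le_trans (vabsD_max _ _)).
by rewrite ge_max lerDl lerDr !vabs_ge0.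
Qed.

End ValuedFieldMetric.

HB.instance Definition _ (R : realType) (K : valuedField R) :=
  isMetric.Build R (vcarrier K)
    vdistxx vdist_positivity vdistC vdist_triangle.

Record is_padic_field (p : nat) (R : realType) (K : valuedField R) : Prop := {
  padic_prime : prime p ;
  padic_complete : forall F : set_system K,
    ProperFilter F -> cauchy F -> exists l : K, F --> l ;
  padic_pchar0 : [pchar vfield K] =i pred0 ;
  padic_vabs_lt1 : vabs (p%:R : K) < 1 ;
  padic_vabs_p : vabs (p%:R : K) = p%:R^-1
}.

Section PowerSeries.
Context {R : realType} {K : valuedField R}.
Implicit Type c : nat -> K.

(* The supremum of the r >= 0 such that |c_n| r^n tends to 0; in the
   non-archimedean setting this is 1 / limsup |c_n|^(1/n). *)
Definition convergence_radius c : \bar R :=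
  ereal_sup [set r%:E | r in
    [set r : R | 0 <= r /\ vabs (c n) * r ^+ n @[n --> \oo] --> (0 : R)]].

(* f is, near 0, the sum of the power series c with positive radius. *)
Definition analytic_at0 c (f : K -> K) : Prop :=
  (0 < convergence_radius c)%E /\
  \forall x \near (0 : K),
    (\sum_(0 <= i < n) c i * x ^+ i) @[n --> \oo] --> f x.

(* The coefficients of x + a x^(m+1) + (terms of degree > m + 1). *)
Definition tangent_to_id_coefs (m : nat) (a : K) c : Prop :=
  [/\ c 0%N = 0, c 1%N = 1,
      forall i, (1 < i <= m)%N -> c i = 0 & c m.+1 = a].

End PowerSeries.

Section Lipeomorphism.
Context {R : realType}.

Definition lipschitz_in (X Y : metricType R) (U : set X) (h : X -> Y) : Prop :=
  exists C : R,
    forall x y, U x -> U y -> mdist (h x) (h y) <= C * mdist x y.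

(* h and k are total functions of which only the restrictions to U and V
   matter; k is the inverse of h. *)
Definition homeomorphism (X Y : metricType R) (U : set X) (V : set Y)
    (h : X -> Y) (k : Y -> X) : Prop :=
  [/\ set_fun U V h, set_fun V U k,
      (forall x, U x -> k (h x) = x) /\ (forall y, V y -> h (k y) = y),
      {within U, continuous h} & {within V, continuous k}].

Definition lipeomorphism (X Y : metricType R) (U : set X) (V : set Y)
    (h : X -> Y) (k : Y -> X) : Prop :=
  [/\ homeomorphism U V h k, lipschitz_in U h & lipschitz_in V k].

End Lipeomorphism.

(* k (f (h x)) only makes sense as h^-1 (f (h x)) if f (h x) lies in V. *)
Definition lipeomorphically_equivalent (R : realType) (K : valuedField R)
    (f g : K -> K) : Prop :=
  exists (U V : set K) (h k : K -> K),
    [/\ nbhs (0 : K) U, nbhs (0 : K) V, lipeomorphism U V h k, h 0 = 0 &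
        \forall x \near (0 : K), V (f (h x)) /\ k (f (h x)) = g x].

(* Main.v *)
Require Import Defs.
From mathcomp Require Import all_boot all_order all_algebra.
From mathcomp Require Import all_classical all_reals all_analysis.
From mathcomp Require Import ring lra.

Set Implicit Arguments.
Unset Strict Implicit.
Unset Printing Implicit Defensive.

Import Order.TTheory GRing.Theory Num.Theory.
Import numFieldNormedType.Exports.

Local Open Scope classical_set_scope.
Local Open Scope ring_scope.

(** Near 0 the displacement [u = f - id] is [t |p|]-Lipschitz for some [t < 1],
    and [|u x| = |a| |x|^(m+1)] depends on the first nonlinear term only; in
    particular the displacements of [f] and [g] agree up to a factor [1 + O(t)].
    The Lipschitz bound alone yields
    [f^n x - x = n (u x)] up to an error of size [t |p|^k |u x|] when [p^k]
    divides [n], so every nontrivial orbit looks like a translated copy of the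
    integers with their p-adic metric.  Hence there is a Fatou coordinate
    [s : K -> Z_p] with [s (g y) = s y + 1] and [|s x - s y| |u y| <= |x - y|],
    and [h y = f^(s y) (g^(- s y) y)] satisfies [h g = f h].  As [f^n] and [g^n]
    are close, [h - id] is a contraction: [h] is a bijective isometry.  All this
    is done for total maps, extending [f] and [g] by the identity outside a
    small ball. *)

(** * Ultrametric inequalities and the absolute values of integers *)

Section Ultrametric.
Context {R : realType} {K : valuedField R}.
Implicit Types (x y : K) (e : R) (n : nat).

Lemma vabs_leD e x y : vabs x <= e -> vabs y <= e -> vabs (x + y) <= e.
Proof. by move=> hx hy; apply: le_trans (vabsD_max _ _) _; rewrite ge_max hx. Qed.

Lemma vabs_leB e x y : vabs x <= e -> vabs y <= e -> vabs (x - y) <= e.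
Proof. by move=> hx hy; apply: vabs_leD; rewrite ?vabsN. Qed.

Lemma vabs_ltD e x y : vabs x < e -> vabs y < e -> vabs (x + y) < e.
Proof. by move=> hx hy; apply: le_lt_trans (vabsD_max _ _) _; rewrite gt_max hx. Qed.

Lemma vabsBC x y : vabs (x - y) = vabs (y - x).
Proof. by rewrite -vabsN opprB. Qed.

Lemma vabsD_eql x y : vabs y < vabs x -> vabs (x + y) = vabs x.
Proof.
move=> h; apply/eqP; rewrite eq_le vabs_leD ?(ltW h) //= leNgt; apply/negP => h'.
have := vabs_ltD h' (y := - y); rewrite vabsN => /(_ h).
by rewrite addrK ltxx.
Qed.

Lemma vabs_eq_dominant x y : vabs (x - y) < vabs y -> vabs x = vabs y.
Proof. by move=> h; rewrite -{1}(subrK y x) addrC vabsD_eql. Qed.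

Lemma vabs_gt0 x : x != 0 -> 0 < vabs x.
Proof.
by move=> /eqP h; rewrite lt_neqAle vabs_ge0 andbT; apply/eqP => /esym/vabs_eq0.
Qed.

Lemma vabsX x n : vabs (x ^+ n) = vabs x ^+ n.
Proof. by elim: n => [|n IH]; rewrite ?expr0 ?vabs1 // !exprS vabsM IH. Qed.

Lemma vabs_nat_le1 n : vabs (n%:R : K) <= 1.
Proof.
elim: n => [|n IH]; first by rewrite vabs0.
by rewrite -natr1 vabs_leD // vabs1.
Qed.

Lemma vabs_sum_le (I : Type) (r : seq I) (P : pred I) (F : I -> K) e :
  0 <= e -> (forall i, P i -> vabs (F i) <= e) -> vabs (\sum_(i <- r | P i) F i) <= e.
Proof.
move=> e0 h; elim/big_ind: _ => //; first by rewrite vabs0.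
by move=> x y; apply: vabs_leD.
Qed.

(** By Bezout, 1 is a difference of a multiple of [p] and a multiple of [q]; if both had absolute
    value below 1, so would 1. *)
Lemma vabs_coprime (p q : nat) :
  prime p -> vabs (p%:R : K) < 1 -> ~~ (p %| q)%N -> vabs (q%:R : K) = 1.
Proof.
move=> pp p1 npq.
have cop : coprime p q by rewrite prime_coprime.
apply/eqP; rewrite eq_le vabs_nat_le1 /= leNgt; apply/negP => q1.
have := @egcdnP p q (prime_gt0 pp) => -[km kn e _].
have : vabs ((km * p)%N%:R - (kn * q)%N%:R : K) < 1.
  apply: vabs_ltD; rewrite ?vabsN natrM vabsM.
    by apply: le_lt_trans p1; rewrite ler_piMl ?vabs_ge0 ?vabs_nat_le1.
  by apply: le_lt_trans q1; rewrite ler_piMl ?vabs_ge0 ?vabs_nat_le1.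
by rewrite e (eqP cop) natrD [_ + 1]addrC addrK vabs1 ltxx.
Qed.

Lemma vabs_pow_sub_le (r : R) x y n : vabs x <= r -> vabs y <= r ->
  vabs (x ^+ n.+1 - y ^+ n.+1) <= r ^+ n * vabs (x - y).
Proof.
move=> hx hy; have r0 : 0 <= r by apply: le_trans hx; apply: vabs_ge0.
elim: n => [|n IH]; first by rewrite expr0 mul1r !expr1.
rewrite (_ : _ - _ = x * (x ^+ n.+1 - y ^+ n.+1) + y ^+ n.+1 * (x - y)); last first.
  by rewrite !exprS; ring.
apply: vabs_leD; rewrite vabsM.
  by rewrite [r ^+ _]exprS -mulrA ler_pM ?vabs_ge0.
by rewrite ler_wpM2r ?vabs_ge0 // vabsX lerXn2r ?nnegrE ?vabs_ge0.
Qed.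

End Ultrametric.

(** * Maps with contracting displacement *)

Section NearIdentity.
Context {R : realType} {K : valuedField R}.
Implicit Types (x y : K) (e : R) (n : nat) (M N : K -> K).

(** The bound is put on the displacement rather than on [M]: for [e < 1] it makes [M] an isometry
    and, by the ultrametric inequality, passes to composites, iterates and inverses with the same
    constant. *)
Definition near_id e M := forall x y,
  vabs ((M x - x) - (M y - y)) <= e * vabs (x - y).

Lemma near_id_isometry e M x y : e < 1 -> near_id e M ->
  vabs (M x - M y) = vabs (x - y).
Proof.
move=> e1 hM; have [->|xy] := eqVneq x y; first by rewrite !subrr.
apply: vabs_eq_dominant.
rewrite (_ : _ - _ = (M x - x) - (M y - y)); last by ring.
apply: le_lt_trans (hM _ _) _.
by rewrite gtr_pMl // vabs_gt0 // subr_eq0.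
Qed.

Lemma near_id_comp e M N : e < 1 -> near_id e M -> near_id e N ->
  near_id e (M \o N).
Proof.
move=> e1 hM hN x y /=.
rewrite (_ : _ - _ = ((M (N x) - N x) - (M (N y) - N y)) + ((N x - x) - (N y - y)));
  last by ring.
by apply: vabs_leD => //; rewrite -(near_id_isometry x y e1 hN).
Qed.

Lemma near_id_iter e M n : 0 <= e < 1 -> near_id e M -> near_id e (iter n M).
Proof.
move=> /andP[e0 e1] hM; elim: n => [|n IH]; last exact: (near_id_comp e1 hM IH).
by move=> x y /=; rewrite !subrr vabs0 mulr_ge0 ?vabs_ge0.
Qed.

(** The displacement of [N] at [x] is minus that of [M] at [N x], and [M] is an isometry. *)
Lemma near_id_inv e M N : e < 1 -> near_id e M -> cancel N M -> near_id e N.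
Proof.
move=> e1 hM NK x y.
have := hM (N x) (N y).
rewrite -(near_id_isometry (N x) (N y) e1 hM) !NK vabsBC.
rewrite (_ : y - N y - (x - N x) = N x - x - (N y - y)); last by ring.
by [].
Qed.

Lemma displacement_iter e M n x : e < 1 -> near_id e M ->
  vabs (M (iter n M x) - iter n M x) = vabs (M x - x).
Proof.
move=> e1 hM; elim: n => //= n IH.
by rewrite (near_id_isometry _ _ e1 hM).
Qed.

Lemma iter_sub_le e M n x : e < 1 -> near_id e M ->
  vabs (iter n M x - x) <= vabs (M x - x).
Proof.
move=> e1 hM; elim: n => [|n IH] /=; first by rewrite subrr vabs0 vabs_ge0.
rewrite -(subrK (iter n M x) (M _)) -addrA; apply: vabs_leD => //.
by rewrite (displacement_iter n x e1 hM).
Qed.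

(** The orbit stays within [|M x - x|] of [x], so each step differs from the first by at most
    [e |M x - x|]; ultrametric errors do not accumulate. *)
Lemma iter_sub_linear e M n x : 0 <= e < 1 -> near_id e M ->
  vabs (iter n M x - x - n%:R * (M x - x)) <= e * vabs (M x - x).
Proof.
move=> /andP[e0 e1] hM; elim: n => [|n IH] /=.
  by rewrite subrr mul0r subr0 vabs0 mulr_ge0 ?vabs_ge0.
rewrite (_ : _ - _ = (iter n M x - x - n%:R * (M x - x)) +
   ((M (iter n M x) - iter n M x) - (M x - x))); last by rewrite -natr1; ring.
apply: vabs_leD => //; apply: le_trans (hM _ _) _.
by rewrite ler_wpM2l // (iter_sub_le _ _ e1).
Qed.

End NearIdentity.

(** * Iterates compared with multiples of the displacement *)

Section Displacement.
Context {R : realType} {K : valuedField R}.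
Context (p : nat) (pp : prime p) (p_gt0 : 0 < vabs (p%:R : K)) (p_lt1 : vabs (p%:R : K) < 1).
Context (t : R) (t01 : 0 <= t < 1).
Local Notation q := (vabs (p%:R : K)).
Implicit Types (x y : K) (F : K -> K).

Let q01 : 0 <= q < 1. Proof. by rewrite vabs_ge0. Qed.

Let tq01 : 0 <= t * q < 1.
Proof.
case/andP: t01 q01 => t0 t1 /andP[q0 q1].
by rewrite mulr_ge0 // mulr_ilt1.
Qed.

(** Induction on [k], iterating [M = F^(p^k)] another [p] times. The old error is multiplied by [p];
    the new one is [t q |M x - x|] with [|M x - x| <= q^k |F x - x|]. The factor [q] in the
    Lipschitz constant makes both of size [t q^(k+1)]. *)
Lemma iter_ppow_sub F k x : near_id (t * q) F ->
  vabs (iter (p ^ k) F x - x - (p ^ k)%:R * (F x - x)) <= t * q ^+ k * vabs (F x - x).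
Proof.
move=> hF; case/andP: t01 q01 => t0 t1 /andP[q0 q1].
elim: k => [|k IH].
  by rewrite expn0 mul1r subrr vabs0 !mulr_ge0 ?exprn_ge0 ?vabs_ge0.
set M := iter (p ^ k) F.
have hM : near_id (t * q) M by apply: near_id_iter.
have Mle : vabs (M x - x) <= q ^+ k * vabs (F x - x).
  rewrite -(subrK ((p ^ k)%:R * (F x - x)) (M x - x)); apply: vabs_leD.
    by apply: le_trans IH _; rewrite ler_wpM2r ?vabs_ge0 // ler_piMl ?exprn_ge0 // ltW.
  by rewrite vabsM natrX vabsX.
rewrite expnS iterM -/M.
rewrite (_ : _ - _ = (iter p M x - x - p%:R * (M x - x)) +
   p%:R * (M x - x - (p ^ k)%:R * (F x - x))); last by rewrite natrM; ring.
apply: vabs_leD.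
  apply: le_trans (iter_sub_linear _ _ tq01 hM) _.
  by rewrite exprS -!mulrA ler_wpM2l // ler_wpM2l.
by rewrite vabsM exprS mulrCA -!mulrA ler_wpM2l // mulrA.
Qed.

Lemma iter_mul_ppow_sub F k n x : near_id (t * q) F ->
  vabs (iter (n * p ^ k) F x - x - (n * p ^ k)%:R * (F x - x))
    <= t * q ^+ k * vabs (F x - x).
Proof.
move=> hF; case/andP: t01 q01 => t0 t1 /andP[q0 q1].
set M := iter (p ^ k) F.
have hM : near_id (t * q) M by apply: near_id_iter.
have h := iter_ppow_sub k x hF.
have Mle : vabs (M x - x) <= q ^+ k * vabs (F x - x).
  rewrite -(subrK ((p ^ k)%:R * (F x - x)) (M x - x)); apply: vabs_leD.
    by apply: le_trans h _; rewrite ler_wpM2r ?vabs_ge0 // ler_piMl ?exprn_ge0 // ltW.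
  by rewrite vabsM natrX vabsX.
rewrite iterM -/M.
rewrite (_ : _ - _ = (iter n M x - x - n%:R * (M x - x)) +
   n%:R * (M x - x - (p ^ k)%:R * (F x - x))); last by rewrite natrM; ring.
apply: vabs_leD.
  apply: le_trans (iter_sub_linear _ _ tq01 hM) _.
  rewrite -!mulrA ler_wpM2l //; apply: le_trans Mle.
  by rewrite ler_piMl ?vabs_ge0 // ltW.
by rewrite vabsM; apply: le_trans h; rewrite ler_piMl ?vabs_ge0 ?vabs_nat_le1.
Qed.

Lemma iter_dvd_sub_le F k n x : near_id (t * q) F -> (p ^ k %| n)%N ->
  vabs (iter n F x - x) <= q ^+ k * vabs (F x - x).
Proof.
move=> hF /dvdnP[d ->]; case/andP: t01 q01 => t0 t1 /andP[q0 q1].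
rewrite -(subrK ((d * p ^ k)%:R * (F x - x)) (_ - x)); apply: vabs_leD.
  apply: le_trans (iter_mul_ppow_sub k d x hF) _.
  by rewrite ler_wpM2r ?vabs_ge0 // ler_piMl ?exprn_ge0 // ltW.
rewrite vabsM ler_wpM2r ?vabs_ge0 // natrM natrX vabsM vabsX.
by rewrite ler_piMl ?exprn_ge0 ?vabs_nat_le1.
Qed.

(** If [n = d p^v] with [d] prime to [p], the linear term has size exactly [q^v |F x - x|] and
    dominates the error, since [t < 1]. So the distance travelled reveals the valuation of [n]. *)
Lemma iter_sub_lt_dvd F k n x : near_id (t * q) F ->
  vabs (iter n F x - x) < q ^+ k * vabs (F x - x) -> (p ^ k.+1 %| n)%N.
Proof.
move=> hF h; case/andP: t01 q01 => t0 t1 /andP[q0 q1].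
have [->//|n0] := posnP n.
have [d nd en] := pfactor_coprime pp n0.
rewrite pfactor_dvdn // leqNgt; apply/negP; rewrite ltnS => lk.
have u0 : 0 < vabs (F x - x).
  rewrite lt_neqAle vabs_ge0 andbT; apply/eqP => u0.
  by move: h; rewrite -u0 mulr0 ltNge vabs_ge0.
have := iter_mul_ppow_sub (logn p n) d x hF.
rewrite -en => h'.
have e1 : vabs (n%:R * (F x - x)) = q ^+ logn p n * vabs (F x - x).
  by rewrite {1}en natrM !vabsM natrX vabsX (vabs_coprime pp) ?mul1r // -prime_coprime.
have : vabs (iter n F x - x) = vabs (n%:R * (F x - x)).
  apply: vabs_eq_dominant; apply: le_lt_trans h' _.
  by rewrite e1 ltr_pM2r // gtr_pMl // exprn_gt0.
rewrite e1 => e2; move: h; rewrite e2 ltr_pM2r // => h.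
by have := lt_le_trans h (ler_wiXn2l q0 (ltW q1) lk); rewrite ltxx.
Qed.

End Displacement.

(** * Limits and fixed points in a complete ultrametric field *)

Section Limits.
Context {R : realType} {K : valuedField R}.
Implicit Types (x y l : K) (b C e : R) (u : nat -> K).

(** This is how limits are taken below: vanishing errors enter ultrametric bounds through a maximum,
    not a sum. *)
Lemma le_of_le_max (a B : R) :
  0 <= B -> (forall e, 0 < e -> a <= Num.max e B) -> a <= B.
Proof.
move=> B0 h; rewrite leNgt; apply/negP => Ba.
have e0 : 0 < (a + B) / 2 by lra.
by have := h _ e0; rewrite le_max => /orP[]; lra.
Qed.

Lemma expr_lt_eventually b e : 0 <= b < 1 -> 0 < e ->
  exists N, forall n, (N <= n)%N -> b ^+ n < e.
Proof.
move=> /andP[b0 b1] e0.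
have : (GRing.exp b : R ^nat) @ \oo --> 0 by apply: cvg_expr; rewrite ger0_norm.
move=> /cvgrPdist_lt /(_ e e0) [N _ hN]; exists N => n Nn.
by have := hN n Nn; rewrite /= sub0r normrN ger0_norm // exprn_ge0.
Qed.

Lemma mul_expr_lt_eventually b C e : 0 <= b < 1 -> 0 <= C -> 0 < e ->
  exists N, forall n, (N <= n)%N -> C * b ^+ n < e.
Proof.
move=> b01 C0 e0; have C1 : 0 < C + 1 by lra.
have [N hN] := expr_lt_eventually b01 (divr_gt0 e0 C1).
exists N => n /hN; rewrite ltr_pdivlMr // mulrC.
apply: le_lt_trans; rewrite ler_wpM2r //; last lra.
by rewrite exprn_ge0; case/andP: b01.
Qed.

Lemma cvg_vabs_lt u l : u @ \oo --> l -> forall e, 0 < e ->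
  exists N, forall n, (N <= n)%N -> vabs (l - u n) < e.
Proof.
move=> /cvg_ballP h e e0; have [N _ hN] := h e e0.
by exists N => n /hN /=; rewrite ballEmdist.
Qed.

Lemma cvg_vabs_le u l x C N : u @ \oo --> l -> 0 <= C ->
  (forall n, (N <= n)%N -> vabs (u n - x) <= C) -> vabs (l - x) <= C.
Proof.
move=> ul C0 h; apply: le_of_le_max => // e e0.
have [N' hN'] := cvg_vabs_lt ul e0.
rewrite -(subrK (u (maxn N N')) l) -addrA; apply: le_trans (vabsD_max _ _) _.
by rewrite ge_max !le_max ltW ?hN' ?leq_maxr // h ?leq_maxl // orbT.
Qed.

Context (K_complete : forall F : set_system K,
  ProperFilter F -> cauchy F -> exists l : K, F --> l).

(** The distance between two terms is at most the largest step between them, so the constant [C] is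
    kept, with no factor [1 / (1 - b)]. *)
Lemma geometric_limit b C u : 0 <= b < 1 ->
  (forall n, vabs (u n.+1 - u n) <= C * b ^+ n) ->
  exists l, forall n, vabs (u n - l) <= C * b ^+ n.
Proof.
move=> b01 hu; have /andP[b0 b1] := b01.
have C0 : 0 <= C.
  by have := le_trans (vabs_ge0 _) (hu 0%N); rewrite expr0 mulr1.
have hk n k : vabs (u (n + k)%N - u n) <= C * b ^+ n.
  elim: k => [|k IH]; first by rewrite addn0 subrr vabs0 mulr_ge0 ?exprn_ge0.
  rewrite addnS -(subrK (u (n + k)%N) (u _.+1)) -addrA; apply: vabs_leD => //.
  apply: le_trans (hu _) _; rewrite ler_wpM2l // ler_wiXn2l // ?ltW //.
  exact: leq_addr.
have hc : cauchy (u @ \oo).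
  apply/cauchy_ballP => e e0.
  have [N hN] := mul_expr_lt_eventually b01 C0 e0.
  exists ([set x | exists2 n, (N <= n)%N & x = u n],
          [set x | exists2 n, (N <= n)%N & x = u n]).
    by split; exists N => // n Nn; exists n.
  move=> [x y] /= [[n Nn ->] [m Nm ->]]; rewrite ballEmdist /=.
  apply: le_lt_trans (hN N (leqnn N)).
  rewrite /mdist /= /vdist -(subrK (u N) (u n)) -addrA.
  rewrite -{1}(subnKC Nn) -{1}(subnKC Nm).
  by apply: vabs_leD; last rewrite vabsBC.
have [l ul] := K_complete _ hc; exists l => n.
rewrite vabsBC; apply: (cvg_vabs_le (N := n) ul).
  by rewrite mulr_ge0 ?exprn_ge0.
by move=> m nm; rewrite -(subnKC nm).
Qed.

(* Banach's fixed point theorem for [z |-> w - (M z - z)]. *)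
Lemma near_id_bijective e M : 0 <= e < 1 -> near_id e M ->
  exists2 N : K -> K, cancel M N & cancel N M.
Proof.
move=> e01 hM; have /andP[e0 e1] := e01.
suff surj w : {z | M z = w}.
  exists (fun w => sval (surj w)) => w; last exact: svalP (surj w).
  case: surj => z /= Mz; apply/vdist_positivity.
  by rewrite /vdist -(near_id_isometry _ _ e1 hM) Mz subrr vabs0.
apply/cid; pose T z := w - (M z - z); pose u n := iter n T w.
have hT x y : vabs (T x - T y) <= e * vabs (x - y).
  by rewrite (_ : _ - _ = (M y - y) - (M x - x)) 1?vabsBC // /T; ring.
have hu n : vabs (u n.+1 - u n) <= vabs (T w - w) * e ^+ n.
  elim: n => [|n IH]; first by rewrite expr0 mulr1.
  by rewrite exprS mulrCA; apply: le_trans (hT _ _) _; rewrite ler_wpM2l.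
have [l hl] := geometric_limit e01 hu.
exists l; apply/subr0_eq/vabs_eq0/eqP; rewrite eq_le vabs_ge0 andbT.
apply: le_of_le_max => // d d0; rewrite le_max; apply/orP; left.
have [n hn] := mul_expr_lt_eventually e01 (vabs_ge0 (T w - w)) d0.
have hn' := ltW (hn n (leqnn n)).
rewrite (_ : M l - w = (u n.+1 - T l) - (u n.+1 - u n) - (u n - l)); last first.
  by rewrite /T; ring.
apply: vabs_leB; last exact: le_trans (hl n) hn'.
apply: vabs_leB; last exact: le_trans (hu n) hn'.
apply: le_trans (hT _ _) (le_trans _ hn'); apply: le_trans (hl n).
by rewrite ler_piMl ?vabs_ge0 // ltW.
Qed.

End Limits.

(** * Finite-level Fatou coordinates *)

Section Phase.
Context {R : realType} {K : valuedField R}.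
Context (p : nat) (pp : prime p).
Context (p_gt0 : 0 < vabs (p%:R : K)) (p_lt1 : vabs (p%:R : K) < 1).
Context (t : R) (t01 : 0 <= t < 1).
Local Notation q := (vabs (p%:R : K)).
Context (F : K -> K) (hF : near_id (t * q) F).
Implicit Types (x y z : K) (k n : nat).

Let q01 : 0 <= q < 1. Proof. by rewrite vabs_ge0. Qed.

Let tq01 : 0 <= t * q < 1.
Proof.
case/andP: t01 q01 => t0 t1 /andP[q0 q1].
by rewrite mulr_ge0 // mulr_ilt1.
Qed.

Let tq1 : t * q < 1. Proof. by case/andP: tq01. Qed.

(* Off by one: [qclose k] determines times along an orbit modulo [p ^ k.+1]. *)
Definition qclose k x y := vabs (x - y) < q ^+ k * vabs (F x - x).

(** The displacement varies by less than its size at [x]. Hence [qclose], though scaled by its first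
    argument, is symmetric and transitive. *)
Lemma qclose_disp k x y : qclose k x y -> vabs (F y - y) = vabs (F x - x).
Proof.
move=> h; apply: vabs_eq_dominant; rewrite vabsBC.
apply: le_lt_trans (hF _ _) _.
apply: (@le_lt_trans _ _ (vabs (x - y))).
  by rewrite ler_piMl ?vabs_ge0 // ltW.
by apply: lt_le_trans h _; rewrite ler_piMl ?vabs_ge0 // exprn_ile1 // ltW.
Qed.

Lemma qclose_disp_gt0 k x y : qclose k x y -> 0 < vabs (F x - x).
Proof.
move=> h; rewrite lt_neqAle vabs_ge0 andbT; apply/eqP => h0.
by move: h; rewrite /qclose -h0 mulr0 ltNge vabs_ge0.
Qed.

Lemma qclose_refl k x : F x != x -> qclose k x x.
Proof.
by move=> h; rewrite /qclose subrr vabs0 mulr_gt0 ?exprn_gt0 // vabs_gt0 // subr_eq0.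
Qed.

Lemma qclose_sym k x y : qclose k x y -> qclose k y x.
Proof. by move=> h; rewrite /qclose (qclose_disp h) vabsBC. Qed.

Lemma qclose_trans k x y z : qclose k x y -> qclose k y z -> qclose k x z.
Proof.
move=> xy yz; rewrite /qclose (_ : x - z = (x - y) + (y - z)); last by ring.
by apply: vabs_ltD => //; rewrite -(qclose_disp xy).
Qed.

Lemma qclose_leq j k x y : (j <= k)%N -> qclose k x y -> qclose j x y.
Proof.
move=> jk h; apply: lt_le_trans h _; rewrite ler_wpM2r ?vabs_ge0 //.
by rewrite ler_wiXn2l // ltW.
Qed.

Lemma qclose_map k x y : qclose k x y -> qclose k (F x) (F y).
Proof. by rewrite /qclose !(near_id_isometry _ _ tq1 hF). Qed.

Lemma qclose_iter k n x y : qclose k x y -> qclose k (iter n F x) (iter n F y).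
Proof. by elim: n => //= n IH /IH /qclose_map. Qed.

Lemma qclose_period k x : F x != x -> qclose k (iter (p ^ k.+1) F x) x.
Proof.
move=> hx; apply: qclose_sym; rewrite /qclose vabsBC.
apply: le_lt_trans (iter_dvd_sub_le p_lt1 t01 x hF (dvdnn _)) _.
by rewrite ltr_pM2r ?vabs_gt0 ?subr_eq0 // exprS gtr_pMl ?exprn_gt0.
Qed.

Lemma qclose_iter_eqmod k m n x : qclose k (iter m F x) (iter n F x) ->
  m = n %[mod p ^ k.+1].
Proof.
wlog mn : m n / (m <= n)%N.
  move=> H; have /orP[mn|nm] := leq_total m n; first exact: H.
  by move/qclose_sym => h; apply/esym/H.
move=> h; apply/eqP; rewrite eq_sym eqn_mod_dvd //.
apply: (iter_sub_lt_dvd pp p_gt0 p_lt1 t01 (x := iter m F x) hF).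
by rewrite -iterD subnK // vabsBC.
Qed.

Lemma iter_neq n x : F x != x -> F (iter n F x) != iter n F x.
Proof.
move=> h; rewrite -subr_eq0; apply/eqP => h0.
have := displacement_iter n x tq1 hF; rewrite h0 vabs0 => /esym/vabs_eq0/eqP.
by rewrite subr_eq0 (negbTE h).
Qed.

Definition qclose_orbit k y := [set x | exists n, qclose k (iter n F x) y].

(** [xget] depends on the set alone, so all points with the same [qclose_orbit] get the same origin
    of time. The default [0] occurs only when [y] is fixed. *)
Definition orbit_repr k y := xget 0 (qclose_orbit k y).

Definition repr_time k y := xget 0%N [set n | qclose k (iter n F (orbit_repr k y)) y].

(* The values of [phase k] matter modulo [p ^ k] only; the limit of [phase k y]
   is a p-adic integer, a Fatou coordinate of [y]. *)
Fixpoint phase k y : nat :=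
  if k is j.+1 then (phase j (orbit_repr j y) + repr_time j y)%N else 0%N.

Lemma qclose_orbit_qclose k x y : qclose k x y -> qclose_orbit k x = qclose_orbit k y.
Proof.
move=> xy; apply/seteqP; split => z [n zn]; exists n.
  exact: qclose_trans zn xy.
exact: qclose_trans zn (qclose_sym xy).
Qed.

Lemma qclose_orbit_map k y : F y != y -> qclose_orbit k (F y) = qclose_orbit k y.
Proof.
move=> hy; apply/seteqP; split => z [n zn]; last by exists n.+1; apply: qclose_map.
(* Up to [qclose k], the iterate of order [p ^ k.+1 - 1] inverts [F]. *)
exists ((p ^ k.+1).-1 + n)%N.
have := qclose_iter (p ^ k.+1).-1 zn.
rewrite -iterD -iterSr prednK ?expn_gt0 ?prime_gt0 // => h.
exact: qclose_trans h (qclose_period k hy).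
Qed.

Lemma repr_timeP k y : F y != y ->
  qclose k (iter (repr_time k y) F (orbit_repr k y)) y.
Proof.
move=> hy; apply: (@xgetPex _ _ [set n | qclose k (iter n F (orbit_repr k y)) y]).
apply: (@xgetPex _ _ (qclose_orbit k y)).
by exists y, 0%N; apply: qclose_refl.
Qed.

Lemma orbit_repr_neq k y : F y != y -> F (orbit_repr k y) != orbit_repr k y.
Proof.
move=> /(repr_timeP k)/qclose_disp_gt0.
by rewrite (displacement_iter _ _ tq1 hF); apply: contraTneq => ->; rewrite subrr vabs0 ltxx.
Qed.

(** Close points share a representative, and their times from it agree modulo [p ^ k.+1] because its
    orbit visits each ball in a single residue class of times. *)
Lemma phase_qclose k x y : F y != y -> qclose k x y ->
  phase k.+1 x = phase k.+1 y %[mod p ^ k.+1].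
Proof.
move=> hy xy.
have hx : F x != x.
  by apply: contraTneq (qclose_disp_gt0 xy) => ->; rewrite subrr vabs0 ltxx.
have er : orbit_repr k x = orbit_repr k y.
  by rewrite /orbit_repr (qclose_orbit_qclose xy).
rewrite /= er -modnDmr -[RHS]modnDmr; congr ((_ + _) %% _)%N.
apply: (@qclose_iter_eqmod k _ _ (orbit_repr k y)).
rewrite -{1}er; apply: qclose_trans (repr_timeP k hx) _.
exact: qclose_trans xy (qclose_sym (repr_timeP k hy)).
Qed.

Lemma phase_map k y : F y != y -> phase k (F y) = (phase k y).+1 %[mod p ^ k].
Proof.
case: k => [|k] hy; first by rewrite expn0 !modn1.
have er : orbit_repr k (F y) = orbit_repr k y.
  by rewrite /orbit_repr qclose_orbit_map.
rewrite /= er -addnS -modnDmr -[RHS]modnDmr; congr ((_ + _) %% _)%N.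
apply: (@qclose_iter_eqmod k _ _ (orbit_repr k y)).
rewrite -{1}er; apply: qclose_trans (repr_timeP k (iter_neq 1 hy)) _.
by apply: qclose_map; apply/qclose_sym/repr_timeP.
Qed.

Lemma phase_iter k n y : F y != y ->
  phase k (iter n F y) = (phase k y + n)%N %[mod p ^ k].
Proof.
move=> hy; elim: n => [|n IH]; first by rewrite addn0.
rewrite iterS phase_map ?iter_neq // addnS -addn1 -modnDml IH modnDml.
by rewrite addn1.
Qed.

(** This is why the recursion adds the phase of the representative: [y] is close to an iterate of
    it, where the coarser phase is that of the representative plus the time, which is the finer
    phase of [y]. *)
Lemma phaseS k y : F y != y -> phase k.+1 y = phase k y %[mod p ^ k].
Proof.
case: k => [|k] hy; first by rewrite expn0 !modn1.
have hr := orbit_repr_neq k.+1 hy.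
rewrite -(phase_qclose hy (qclose_leq (leqnSn k) (repr_timeP k.+1 hy))).
by rewrite phase_iter.
Qed.

Lemma phase_leq j k y : F y != y -> (j <= k)%N ->
  phase k y = phase j y %[mod p ^ j].
Proof.
move=> hy /subnKC <-; elim: (k - j)%N => [|n IH]; first by rewrite addn0.
rewrite -IH addnS -(modn_dvdm _ (dvdn_exp2l p (leq_addr n j))).
by rewrite phaseS // modn_dvdm // dvdn_exp2l // leq_addr.
Qed.

End Phase.

(** * Construction of the conjugacy *)

Section Conjugacy.
Context {R : realType} {K : valuedField R}.
Context (p : nat) (pp : prime p).
Context (p_gt0 : 0 < vabs (p%:R : K)) (p_lt1 : vabs (p%:R : K) < 1).
Context (t : R) (t01 : 0 <= t < 1).
Local Notation q := (vabs (p%:R : K)).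
Context (F G : K -> K) (hF : near_id (t * q) F) (hG : near_id (t * q) G).
Context (hFG : forall x, vabs ((G x - x) - (F x - x)) <= t * vabs (F x - x)).
Implicit Types (x y : K) (k n s : nat).

Let q01 : 0 <= q < 1. Proof. by rewrite vabs_ge0. Qed.

Let tq01 : 0 <= t * q < 1.
Proof.
case/andP: t01 q01 => t0 t1 /andP[q0 q1].
by rewrite mulr_ge0 // mulr_ilt1.
Qed.

Let tq1 : t * q < 1. Proof. by case/andP: tq01. Qed.

Lemma disp_le x : vabs (G x - x) <= vabs (F x - x).
Proof.
rewrite -(subrK (F x - x) (G x - x)); apply: vabs_leD => //.
by apply: le_trans (hFG x) _; rewrite ler_piMl ?vabs_ge0 // ltW; case/andP: t01.
Qed.

(** Both iterates are compared with their linear terms, whose difference is [n] times the gap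
    between the two displacements; [|n| <= q^k]. *)
Lemma iter_sub_iter_le k n x : (p ^ k %| n)%N ->
  vabs (iter n G x - iter n F x) <= t * q ^+ k * vabs (F x - x).
Proof.
case/andP: t01 q01 => t0 t1 /andP[q0 q1] /dvdnP[d ->]; set n' := (d * p ^ k)%N.
rewrite (_ : _ - _ = (iter n' G x - x - n'%:R * (G x - x))
  - (iter n' F x - x - n'%:R * (F x - x))
  + n'%:R * ((G x - x) - (F x - x))); last by ring.
apply: vabs_leD; first apply: vabs_leB.
- apply: le_trans (iter_mul_ppow_sub p_lt1 t01 k d x hG) _.
  by rewrite ler_wpM2l ?disp_le // mulr_ge0 // exprn_ge0.
- exact: (iter_mul_ppow_sub p_lt1 t01 k d x hF).
- rewrite vabsM natrM natrX vabsM vabsX [t * _]mulrC -!mulrA.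
  apply: (@le_trans _ _ (q ^+ k * vabs (G x - x - (F x - x)))).
    by rewrite ler_piMl ?vabs_nat_le1 // mulr_ge0 ?exprn_ge0 ?vabs_ge0.
  by rewrite ler_wpM2l ?exprn_ge0 ?hFG.
Qed.

Context (F' : K -> K) (FK : cancel F F') (F'K : cancel F' F).

Let hF' : near_id (t * q) F'. Proof. exact: near_id_inv tq1 hF F'K. Qed.

(** Since [shift s.+1 (F y) = G (shift s y)], a time [s] that grows by one under [F] turns [shift]
    into a conjugacy. *)
Let shift s y := iter s G (iter s F' y).

Let iterF'K n : cancel (iter n F') (iter n F).
Proof. by elim: n => // n IH x; rewrite iterSr /= F'K IH. Qed.

Lemma shift_near_id s : near_id (t * q) (shift s).
Proof. exact: near_id_comp tq1 (near_id_iter s tq01 hG) (near_id_iter s tq01 hF'). Qed.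

Lemma disp_iter_inv n x :
  vabs (F (iter n F' x) - iter n F' x) = vabs (F x - x).
Proof. by rewrite -(displacement_iter n (iter n F' x) tq1 hF) iterF'K. Qed.

Lemma shift_eqmod k s s' y : s = s' %[mod p ^ k] ->
  vabs (shift s y - shift s' y) <= t * q ^+ k * vabs (F y - y).
Proof.
wlog ss : s s' / (s' <= s)%N.
  move=> H; have /orP[ss|ss] := leq_total s' s; first exact: H.
  by rewrite vabsBC => /esym; apply: H.
move=> /eqP; rewrite eqn_mod_dvd // => h.
set n := (s - s')%N in h; set z := iter s' F' y.
(* After removing the isometry [iter s' G], it remains to compare [G^n] and [F^n] at the point
   [iter n F' z], with [p ^ k] dividing [n]. *)
have -> : shift s y = iter s' G (iter n G (iter n F' z)).
  by rewrite /z -!iterD /shift /n subnK // subnKC.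
rewrite (near_id_isometry _ _ tq1 (near_id_iter s' tq01 hG)).
rewrite -[X in _ - X](iterF'K n).
by apply: le_trans (iter_sub_iter_le _ h) _; rewrite !disp_iter_inv.
Qed.

(** Phases carry information only off the fixed points; at a fixed point every [shift] agrees. *)
Lemma shift_eqmod_nonfixed k s s' y : (F y != y -> s = s' %[mod p ^ k]) ->
  vabs (shift s y - shift s' y) <= t * q ^+ k * vabs (F y - y).
Proof.
have [Fy _|_] := eqVneq (F y) y; last by move/(_ isT); apply: shift_eqmod.
have := @shift_eqmod 0 s s' y; rewrite expn0 !modn1 => /(_ erefl).
by rewrite Fy subrr vabs0 !mulr0.
Qed.

Lemma exists_eqmod_phase x y : x != y -> exists2 j,
  q ^+ j * vabs (F y - y) <= vabs (x - y) &
  F y != y -> forall k, (j <= k)%N ->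
    phase p F k x = phase p F k y %[mod p ^ j].
Proof.
move=> xy; have xy0 : 0 < vabs (x - y) by rewrite vabs_gt0 // subr_eq0.
have hex : exists j, q ^+ j * vabs (F y - y) <= vabs (x - y).
  have [N hN] := mul_expr_lt_eventually q01 (vabs_ge0 (F y - y)) xy0.
  by exists N; rewrite mulrC; apply: ltW; apply: hN.
case: (ex_minnP hex) => j hj jmin; exists j => // hy k jk.
case: j hj jmin jk => [|i] hj jmin jk; first by rewrite expn0 !modn1.
have hyx : qclose p F i y x.
  by rewrite /qclose vabsBC ltNge; apply/negP => /jmin; rewrite ltnn.
have hxy := qclose_sym p_gt0 p_lt1 t01 hF hyx.
have hx : F x != x.
  by rewrite -subr_eq0; apply: contraTneq (qclose_disp_gt0 hxy) => ->; rewrite vabs0 ltxx.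
rewrite (phase_leq pp p_gt0 p_lt1 t01 hF hx jk) (phase_leq pp p_gt0 p_lt1 t01 hF hy jk).
exact: (phase_qclose pp p_gt0 p_lt1 t01 hF hy hxy).
Qed.

Context (K_complete : forall E : set_system K,
  ProperFilter E -> cauchy E -> exists l : K, E --> l).

Lemma conjugacy : exists2 h : K -> K, near_id t h &
  (forall x, h (F x) = G (h x)) /\ (forall x, F x = x -> h x = x).
Proof.
have /andP[t0 t1] := t01; have /andP[q0 q1] := q01.
pose u y k := shift (phase p F k y) y.
(* [h y] is the limit of shifts by the phases of [y], which are compatible modulo powers of [p]. *)
have /choice[h hh] : forall y, exists l, forall k,
    vabs (u y k - l) <= t * vabs (F y - y) * q ^+ k.
  move=> y; apply: (geometric_limit K_complete q01) => k; rewrite mulrAC.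
  apply: shift_eqmod_nonfixed => hy.
  exact: (phaseS pp p_gt0 p_lt1 t01 hF).
have C0 y : 0 <= t * vabs (F y - y) by rewrite mulr_ge0 ?vabs_ge0.
exists h; last split.
- move=> x y; have [->|xy] := eqVneq x y; first by rewrite !subrr vabs0 mulr0.
  have txy0 : 0 <= t * vabs (x - y) by rewrite mulr_ge0 ?vabs_ge0.
  have [j hj hjk] := exists_eqmod_phase xy.
  apply: le_of_le_max => // e e0.
  have [Nx hNx] := mul_expr_lt_eventually q01 (C0 x) e0.
  have [Ny hNy] := mul_expr_lt_eventually q01 (C0 y) e0.
  pose k := maxn j (maxn Nx Ny).
  have jk : (j <= k)%N by rewrite leq_maxl.
  have kx : (Nx <= k)%N by rewrite /k !leq_max leqnn orbT.
  have ky : (Ny <= k)%N by rewrite /k !leq_max leqnn !orbT.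
  (* Apart from two limit errors there is a shift of [x] and [y] by one common time, and a change of
     time at [y] costing at most [t q^j |F y - y| <= t |x - y|]. *)
  rewrite (_ : _ - _ = - (u x k - h x) + (u y k - h y)
    + ((u x k - x - (shift (phase p F k x) y - y))
       + (shift (phase p F k x) y - u y k))); last by ring.
  apply: vabs_leD; first apply: vabs_leD.
  + by rewrite vabsN le_max (le_trans (hh x k)) // ltW // hNx.
  + by rewrite le_max (le_trans (hh y k)) // ltW // hNy.
  apply: (@le_trans _ _ (t * vabs (x - y))); last by rewrite le_max lexx orbT.
  apply: vabs_leD.
    apply: le_trans (shift_near_id _ _ _) _.
    by rewrite ler_wpM2r ?vabs_ge0 // ler_piMr // ltW.
  apply: le_trans (shift_eqmod_nonfixed (k := j) _) _; first by move=> hy; apply: hjk.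
  by rewrite -mulrA ler_wpM2l.
- move=> x; apply/vdist_positivity; apply/eqP; rewrite eq_le vabs_ge0 andbT.
  apply: le_of_le_max => // e e0.
  have [k hk] := mul_expr_lt_eventually q01 (C0 x) e0.
  have {}hk := ltW (hk k (leqnn k)).
  rewrite le_max; apply/orP; left; apply: le_trans hk.
  have dFx : vabs (F (F x) - F x) = vabs (F x - x).
    exact: (displacement_iter 1 x tq1 hF).
  (* The middle term replaces the phase of [F x] by one plus the phase of [x]; the shift then
     becomes exactly [G (u x k)]. *)
  rewrite /vdist (_ : _ - _ = - (u (F x) k - h (F x))
    + (u (F x) k - shift (phase p F k x).+1 (F x))
    + (G (u x k) - G (h x))); last first.
    by rewrite /u /shift [in iter _.+1 F' _]iterSr FK /=; ring.
  apply: vabs_leD; first apply: vabs_leD.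
  + by rewrite vabsN; apply: le_trans (hh (F x) k) _; rewrite dFx.
  + rewrite mulrAC -dFx; apply: shift_eqmod_nonfixed => hFx.
    apply: (phase_map pp p_gt0 p_lt1 t01 hF).
    by apply: contraNneq hFx => e'; rewrite !e'.
  + by rewrite (near_id_isometry _ _ tq1 hG).
(* At level 0 the shift is the identity, and at a fixed point its error bound is zero. *)
- move=> x Fx; apply/esym/vdist_positivity/eqP; rewrite eq_le vabs_ge0 andbT.
  by have := hh x 0%N; rewrite /u /shift /= Fx subrr vabs0 mulr0 mul0r.
Qed.

End Conjugacy.

(** * Estimates for power series near 0 *)

Section Series.
Context {R : realType} {K : valuedField R}.
Implicit Types (x y : K) (c : nat -> K) (f : K -> K) (e r : R).

Lemma analytic_coef_bound c : (0 < convergence_radius c)%E ->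
  exists2 r, 0 < r & exists2 B, 0 < B & forall n, vabs (c n) * r ^+ n <= B.
Proof.
move=> /ereal_sup_gt[_ [r [r0 cr] <-]]; rewrite lte_fin => r_gt0.
exists r => //.
have /cvg_seq_bounded[M [_ hM]] : cvgn (fun n => vabs (c n) * r ^+ n).
  by apply/cvg_ex; exists 0.
have M1 : M < Num.max M 0 + 1 by rewrite ltr_pwDr // le_max lexx.
exists (Num.max M 0 + 1) => [|n]; first by rewrite ltr_wpDl // le_max lexx orbT.
exact: le_trans (ler_norm _) (hM _ M1 n I).
Qed.

(** Used with [j = 1] to bound the variation of the displacement, and with [j = m + 1] to bound the
    remainder beyond the leading term. *)
Lemma analytic_tail_le c j e : (0 < convergence_radius c)%E -> 0 < e ->
  exists2 r, 0 < r & forall n s, 0 <= s <= r -> vabs (c (j + n.+1)%N) * s ^+ n.+1 <= e.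
Proof.
move=> /analytic_coef_bound[d d0 [B B0 hB]] e0.
have dj := exprn_gt0 j d0.
(* Shrinking the radius [d] by [k <= 1] gains [k^(n+1) <= k] on each term, so one factor [k] has to
   turn [B / d^j] into at most [e]. *)
pose k := Num.min 1 (e * d ^+ j / B).
have k0 : 0 < k by rewrite lt_min ltr01 divr_gt0 // mulr_gt0.
have k1 : k <= 1 by rewrite ge_min lexx.
have kB : B * k <= e * d ^+ j.
  by rewrite mulrC -ler_pdivlMr // ge_min lexx orbT.
exists (k * d) => [|n s /andP[s0 sr]]; first by rewrite mulr_gt0.
apply: (@le_trans _ _ (vabs (c (j + n.+1)%N) * (k * d) ^+ n.+1)).
  by rewrite ler_wpM2l ?vabs_ge0 // lerXn2r // nnegrE // (le_trans s0).
rewrite -(ler_pM2r dj); apply: le_trans kB.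
rewrite exprMn mulrCA -!mulrA -exprD addnC mulrC.
have [k0' d0'] := (ltW k0, ltW d0).
apply: ler_pM; rewrite ?mulr_ge0 ?vabs_ge0 ?exprn_ge0 //; last first.
  by rewrite exprS ler_piMr ?exprn_ile1.
Qed.

Lemma series_near_id c f e : c 1%N = 1 -> analytic_at0 c f -> 0 < e ->
  exists2 r, 0 < r & forall x y, vabs x <= r -> vabs y <= r ->
    vabs ((f x - x) - (f y - y)) <= e * vabs (x - y).
Proof.
move=> c1 [/(analytic_tail_le 1)h /nbhs_ballP[d /= d0 hd]] e0.
have [r r0 hr] := h e e0.
exists (Num.min r (d / 2)) => [|x y]; first by rewrite lt_min r0 divr_gt0.
set s := Num.min _ _ => hx hy.
have sd : s < d.
  by apply: le_lt_trans (_ : d / 2 < d); [rewrite ge_min lexx orbT | lra].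
have conv z : vabs z <= s ->
    (\sum_(0 <= i < n) c i * z ^+ i) @[n --> \oo] --> f z.
  move=> hz; apply: hd; rewrite ballEmdist /= /mdist /= /vdist sub0r vabsN.
  exact: le_lt_trans hz sd.
have s01 : 0 <= s <= r by rewrite (le_trans (vabs_ge0 _) hx) ge_min lexx.
have C0 : 0 <= e * vabs (x - y) by rewrite mulr_ge0 ?vabs_ge0 // ltW.
apply: le_of_le_max => // e' e'0.
have [Nx hNx] := cvg_vabs_lt (conv _ hx) e'0.
have [Ny hNy] := cvg_vabs_lt (conv _ hy) e'0.
(* The [.+2] lets the terms of degrees 0 and 1 be split off. *)
pose n := (maxn Nx Ny).+2.
have nx : (Nx <= n)%N by rewrite /n -addn2 (leq_trans (leq_maxl _ Ny)) // leq_addr.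
have ny : (Ny <= n)%N by rewrite /n -addn2 (leq_trans (leq_maxr Nx _)) // leq_addr.
pose S z := \sum_(0 <= i < n) c i * z ^+ i.
have SE z : S z = c 0%N + z + \sum_(2 <= i < n) c i * z ^+ i.
  by rewrite /S big_ltn // big_ltn // expr0 mulr1 c1 mul1r expr1 addrA.
rewrite (_ : _ - _ = (f x - S x) - (f y - S y) + ((S x - x) - (S y - y)));
  last by ring.
apply: vabs_leD; first apply: vabs_leB.
- by rewrite le_max ltW // hNx.
- by rewrite le_max ltW // hNy.
apply: (@le_trans _ _ (e * vabs (x - y))); last by rewrite le_max lexx orbT.
rewrite (_ : _ - _ = \sum_(2 <= i < n) c i * (x ^+ i - y ^+ i)); last first.
  rewrite !SE; under [in RHS]eq_bigr do rewrite mulrBr.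
  by rewrite sumrB; ring.
rewrite big_seq_cond; apply: vabs_sum_le => // i.
rewrite mem_index_iota andbT => /andP[i2 _].
have [k ->] : exists k, i = k.+2 by exists (i - 2)%N; rewrite -addn2 subnK.
rewrite vabsM; apply: le_trans (ler_wpM2l (vabs_ge0 _) (vabs_pow_sub_le _ hx hy)) _.
by rewrite mulrA ler_wpM2r ?vabs_ge0 // (hr k s s01).
Qed.

Lemma series_tangent m a c f e : (1 <= m)%N -> tangent_to_id_coefs m a c ->
  analytic_at0 c f -> 0 < e ->
  exists2 r, 0 < r & forall x, vabs x <= r ->
    vabs (f x - (x + a * x ^+ m.+1)) <= e * vabs x ^+ m.+1.
Proof.
move=> m1 [c0 c1 cm ca] [/(analytic_tail_le m.+1)h /nbhs_ballP[d /= d0 hd]] e0.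
have [r r0 hr] := h e e0.
exists (Num.min r (d / 2)) => [|x]; first by rewrite lt_min r0 divr_gt0.
rewrite le_min => /andP[xr xd].
have conv : (\sum_(0 <= i < n) c i * x ^+ i) @[n --> \oo] --> f x.
  apply: hd; rewrite ballEmdist /= /mdist /= /vdist sub0r vabsN.
  by apply: le_lt_trans xd _; lra.
have C0 : 0 <= e * vabs x ^+ m.+1 by rewrite mulr_ge0 ?exprn_ge0 ?vabs_ge0 // ltW.
apply: (cvg_vabs_le (N := m.+2) conv C0) => n mn.
have -> : \sum_(0 <= i < n) c i * x ^+ i =
    x + a * x ^+ m.+1 + \sum_(m.+2 <= i < n) c i * x ^+ i.
  rewrite (big_cat_nat (n := m.+1)) //=; last exact: ltnW.
  rewrite (big_ltn mn) ca addrA; congr (_ + _ + _).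
  rewrite big_ltn // big_ltn // c0 c1 mul0r mul1r expr1 add0r big_nat_cond big1 ?addr0 //.
  by move=> i /andP[hi _]; rewrite cm ?mul0r.
rewrite addrC addrA addNr add0r big_seq_cond; apply: vabs_sum_le => // i.
rewrite mem_index_iota andbT => /andP[im _].
have [k ->] : exists k, i = (m.+1 + k.+1)%N.
  by exists (i - m.+2)%N; rewrite addnS -addSn subnKC.
rewrite exprD vabsM vabsM !vabsX mulrCA [leLHS]mulrC ler_wpM2r ?exprn_ge0 ?vabs_ge0 //.
by apply: hr; rewrite vabs_ge0.
Qed.

Definition extend_id r f x := if vabs x <= r then f x else x.

(** For [x] inside the ball and [y] outside, [|x - y| = |y| > |x|], so the bound between [x] and 0
    already suffices. *)
Lemma near_id_extend_id e r f : 0 <= e -> 0 <= r -> f 0 = 0 ->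
  (forall x y, vabs x <= r -> vabs y <= r ->
    vabs ((f x - x) - (f y - y)) <= e * vabs (x - y)) ->
  near_id e (extend_id r f).
Proof.
move=> e0 r0 f0 hf.
have mixed x y : vabs x <= r -> r < vabs y -> vabs (f x - x) <= e * vabs (x - y).
  move=> xr yr; have := hf x 0 xr; rewrite vabs0 f0 !subr0 => /(_ r0) h.
  apply: le_trans h _; rewrite ler_wpM2l // vabsBC vabsD_eql ?vabsN; last first.
    exact: le_lt_trans xr yr.
  exact: ltW (le_lt_trans xr yr).
move=> x y; rewrite /extend_id.
have [xr|xr] := leP (vabs x) r; have [yr|yr] := leP (vabs y) r.
- exact: hf.
- by rewrite subrr subr0; apply: mixed.
- by rewrite subrr sub0r vabsN [vabs (x - y)]vabsBC; apply: mixed.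
- by rewrite !subrr vabs0 mulr_ge0 ?vabs_ge0.
Qed.

End Series.

(** * From total maps back to germs *)

Theorem theorem1p2 (R : realType) (p : nat) (K : valuedField R)
    (hK : is_padic_field p K) (m : nat) (hm : (1 <= m)%N)
    (a : K) (ha : a <> 0) (c d : nat -> K) (f g : K -> K)
    (hc : tangent_to_id_coefs m a c) (hf : analytic_at0 c f)
    (hd : tangent_to_id_coefs m a d) (hg : analytic_at0 d g) :
  lipeomorphically_equivalent f g.
Proof.
have pp := padic_prime hK; have p_lt1 := padic_vabs_lt1 hK.
have p_gt0 : 0 < vabs (p%:R : K).
  by rewrite (padic_vabs_p hK) invr_gt0 ltr0n prime_gt0.
pose t : R := 1 / 2; have t0 : 0 < t by rewrite /t; lra.
have t1 : t < 1 by rewrite /t; lra.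
have t01 : 0 <= t < 1 by rewrite ltW.
have tq0 : 0 < t * vabs (p%:R : K) by rewrite mulr_gt0.
have tq01 : 0 <= t * vabs (p%:R : K) < 1 by rewrite ltW //= mulr_ilt1 // ltW.
have ta0 : 0 < t * vabs a by rewrite mulr_gt0 // vabs_gt0 //; apply/eqP.
have [_ c1 _ _] := hc; have [_ d1 _ _] := hd.
have [r1 r10 nf] := series_near_id c1 hf tq0.
have [r2 r20 ng] := series_near_id d1 hg tq0.
have [r3 r30 tf] := series_tangent hm hc hf ta0.
have [r4 r40 tg] := series_tangent hm hd hg ta0.
pose r := Num.min (Num.min r1 r2) (Num.min r3 r4).
have r0 : 0 < r by rewrite !lt_min r10 r20 r30 r40.
have rle (x : K) : vabs x <= r ->
    [/\ vabs x <= r1, vabs x <= r2, vabs x <= r3 & vabs x <= r4].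
  by rewrite !le_min => /andP[/andP[-> ->] /andP[-> ->]].
(* The tangency estimate at [x = 0] forces the value 0 there. *)
have zero k (rk : R) : 0 < rk -> (forall x, vabs x <= rk ->
    vabs (k x - (x + a * x ^+ m.+1)) <= t * vabs a * vabs x ^+ m.+1) -> k 0 = 0.
  move=> rk0 /(_ 0); rewrite vabs0 !expr0n !mulr0 addr0 subr0 => /(_ (ltW rk0)) h.
  by apply/vabs_eq0/eqP; rewrite eq_le h vabs_ge0.
have f0 := zero f _ r30 tf; have g0 := zero g _ r40 tg.
(* The roles are swapped: [h F = G h] must become [h g = f h]. *)
pose F := extend_id r g; pose G := extend_id r f.
have hF : near_id (t * vabs (p%:R : K)) F.
  apply: near_id_extend_id (ltW tq0) (ltW r0) g0 _ => x y.
  by move=> /rle[_ ? _ _] /rle[_ ? _ _]; apply: ng.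
have hG : near_id (t * vabs (p%:R : K)) G.
  apply: near_id_extend_id (ltW tq0) (ltW r0) f0 _ => x y.
  by move=> /rle[? _ _ _] /rle[? _ _ _]; apply: nf.
have hFG x : vabs ((G x - x) - (F x - x)) <= t * vabs (F x - x).
  rewrite /F /G /extend_id; case: ifP => [xr|_]; last by rewrite !subrr vabs0 mulr0.
  have [_ _ /tf hfx /tg hgx] := rle _ xr.
  set v := a * x ^+ m.+1 in hfx hgx.
  have vE : t * vabs a * vabs x ^+ m.+1 = t * vabs v by rewrite vabsM vabsX mulrA.
  rewrite vE in hfx hgx.
  (* The leading term [v] dominates the error [t |v|]. *)
  have -> : vabs (g x - x) = vabs v.
    have [v0|v0] := eqVneq v 0.
      move: hgx; rewrite v0 vabs0 mulr0 addr0 => h.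
      by apply/eqP; rewrite eq_le h vabs_ge0.
    apply: vabs_eq_dominant; rewrite (_ : _ - _ = g x - (x + v)); last by ring.
    by apply: le_lt_trans hgx _; rewrite gtr_pMl // vabs_gt0.
  rewrite (_ : _ - _ = (f x - (x + v)) - (g x - (x + v))); last by ring.
  exact: vabs_leB.
have [F' FK F'K] := near_id_bijective (padic_complete hK) tq01 hF.
have [h hh [hconj hfix]] :=
  conjugacy pp p_gt0 p_lt1 t01 hF hG hFG FK F'K (padic_complete hK).
have [k hk kh] := near_id_bijective (padic_complete hK) t01 hh.
have kk := near_id_inv t1 hh kh.
have h0 : h 0 = 0.
  by apply: hfix; rewrite /F /extend_id vabs0 ltW // g0.
have iso (N : K -> K) : near_id t N -> lipschitz_in setT N /\ {within setT, continuous N}.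
  move=> hN; have isoN x y : mdist (N x) (N y) = mdist x y.
    exact: (near_id_isometry x y t1 hN).
  split; first by exists 1 => x y _ _; rewrite isoN mul1r.
  apply: continuous_subspaceT => x A /nbhs_ballP[e e0 eA].
  apply/nbhs_ballP; exists e => // y; rewrite ballEmdist /= => xy.
  by apply: eA; rewrite ballEmdist /= isoN.
have [Lh Ch] := iso h hh; have [Lk Ck] := iso k kk.
exists setT, setT, h, k; split; [exact: filterT|exact: filterT|by []|exact: h0|].
apply/nbhs_ballP; exists r => //= x; rewrite ballEmdist /= => xr.
have {}xr : vabs x <= r by move: xr; rewrite /mdist /= /vdist sub0r vabsN => /ltW.
split => //; have := hconj x; rewrite /F /G /extend_id xr.
(* [h] is an isometry fixing 0, so [h x] stays in the ball where [G] is [f]. *)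
have -> : vabs (h x) = vabs x.
  by rewrite -[h x]subr0 -h0 (near_id_isometry _ _ t1 hh) subr0.
by rewrite xr => <-; rewrite hk.
Qed.
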